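(* Let $H$ be a hypergraph on vertex set $V=\{v_1,\dots,v_n\}$ with edge set $E$, and let $X\subseteq E$. Then $X$ is a spanning forest (resp. spanning tree) of $H$ if and only if there is a map assigning to each $e_k\in X$ a pair $\{v_i,v_j\}$ of distinct vertices with $v_i,v_j\in e_k$, such that the resulting $|X|$ pairs, regarded as edges of the complete graph $K_n$ on $V$, form a forest (resp. a spanning tree) of $K_n$.
   Context: Edges of $H$ are nonempty subsets of $V$. A subset $C\subseteq E$ is a cycle if $|C|=|\bigcup_{e\in C}e|$ and no proper nonempty subset of $C$ has this property. A spanning forest of $H$ is a set of edges containing no cycle; a spanning tree is a spanning forest with exactly $n-1$ edges. *)

(* Defs.v *)
From mathcomp Require Import all_boot.

Set Implicit Arguments.
Unset Strict Implicit.
Unset Printing Implicit Defensive.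

Record hypergraph (V : finType) := Hypergraph {
  edges : {set {set V}};
  edges_neq0 : forall e, e \in edges -> e != set0
}.

Section Hypergraph.

Variables (V : finType) (H : hypergraph V).
Implicit Types C D X : {set {set V}}.

(* [cover C] is the union of the edges in [C]. A cycle is required to be
   nonempty: [set0] satisfies #|C| = #|cover C| trivially, and if it counted
   as a cycle then no edge set would be acyclic. *)
Definition hcycle C : Prop :=
  [/\ C \subset edges H, C != set0, #|C| = #|cover C| &
      forall D, D \proper C -> D != set0 -> #|D| <> #|cover D|].

Definition hforest X : Prop :=
  X \subset edges H /\ forall C, C \subset X -> ~ hcycle C.

(* #|X| = n - 1, written without truncated subtraction. *)
Definition htree X : Prop := hforest X /\ #|X|.+1 = #|V|.

End Hypergraph.

Section CompleteGraph.

Variable V : finType.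
Implicit Type S : {set {set V}}.

Definition complete_edges : {set {set V}} := [set A : {set V} | #|A| == 2].

Definition adj S : rel V := fun x y => [set x; y] \in S.

(* The bound on the length excludes the closed walk x, y, x along one edge. *)
Definition gforest S : Prop :=
  S \subset complete_edges /\
  forall c : seq V, 2 < size c -> ~ ucycle (adj S) c.

(* The graph with no vertex is not a tree. *)
Definition gtree S : Prop :=
  [/\ gforest S, 0 < #|V| & forall x y : V, connect (adj S) x y].

End CompleteGraph.

(* [f] chooses two distinct vertices in each edge of [X]; only its values on
   [X] matter. Injectivity says that the chosen pairs are #|X| distinct edges
   of the complete graph, so that [f @: X] loses no multiplicity. *)
Definition pair_selection (V : finType) (X : {set {set V}})
    (f : {set V} -> {set V}) : Prop :=
  (forall e, e \in X ->
     exists u v : V, [/\ u != v, u \in e, v \in e & f e = [set u; v]]) /\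
  {in X &, injective f}.

(* Main.v *)
Require Import Defs.
From mathcomp Require Import all_boot zify.

Set Implicit Arguments.
Unset Strict Implicit.
Unset Printing Implicit Defensive.

(** The absence of hypergraph cycles is the strong Hall condition
    [#|C| < #|cover C|] for every nonempty [C]. Submodularity of
    [C |-> #|cover C|] shows that, as long as an edge has at least three
    vertices, one of any two of them can be deleted without breaking the
    condition (Lovász); edges are regarded as an indexed family, since distinct
    edges might otherwise merge. Once all edges are pairs, the condition forbids
    graph cycles. Conversely a graph forest has fewer edges inside a nonempty
    vertex set [A] than [A] has vertices, which gives back the strong Hall
    condition, and this count settles the case of trees. *)

(** * Strong Hall families and their reduction to pairs *)

Section StrongHall.

Variables I V : finType.
Implicit Types (X C : {set I}) (F G : I -> {set V}).

Definition strong_hall X F : Prop :=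
  forall C, C \subset X -> C != set0 -> #|C| < #|\bigcup_(i in C) F i|.

Definition delete_at F i x : I -> {set V} :=
  fun j => if j == i then F i :\ x else F j.

Lemma strong_hall_or_violation X F :
  strong_hall X F \/
  exists C, [/\ C \subset X, C != set0 & #|\bigcup_(i in C) F i| <= #|C|].
Proof.
case: (boolP [exists C : {set I},
  [&& C \subset X, C != set0 & #|\bigcup_(i in C) F i| <= #|C|]]).
  by case/existsP=> C /and3P[? ? ?]; right; exists C.
move/existsPn=> noC; left=> C CX C0.
by have := noC C; rewrite CX C0 /= -ltnNge.
Qed.

(** A violating set must contain [i], since otherwise the deletion does not change its union. [A] is
    that set without [i], hence the bound [#|A|.+1]. *)
Lemma delete_at_violation X F i x :
  strong_hall X F -> strong_hall X (delete_at F i x) \/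
  exists A : {set I}, [/\ i \notin A, i |: A \subset X &
    #|F i :\ x :|: \bigcup_(j in A) F j| <= #|A|.+1].
Proof.
move=> hF.
case: (strong_hall_or_violation X (delete_at F i x)) => [|[C [CX C0 leC]]].
  by left.
right.
have eqG (A : {set I}) : i \notin A ->
    \bigcup_(j in A) delete_at F i x j = \bigcup_(j in A) F j.
  move=> iA; apply: eq_bigr => j jA; rewrite /delete_at.
  by case: eqP jA iA => // -> ->.
have iC : i \in C.
  by apply/negPn/negP=> iC; have := hF C CX C0; rewrite -(eqG C iC) ltnNge leC.
exists (C :\ i); rewrite setD11 setD1K //; split=> //.
move: leC; rewrite (big_setD1 i) //= eqG ?setD11 // {1}/delete_at eqxx.
by rewrite (cardsD1 i C) iC.
Qed.

(** If deleting [x] and deleting [y] both fail, the violations give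
    [#|P| + #|Q| <= #|A| + #|B| + 2]. Strong Hall on [i |: (A :|: B)] and on [A :&: B] makes the
    same sum at least [#|A| + #|B| + 3]. *)
Lemma strong_hall_delete X F i :
  strong_hall X F -> i \in X -> 2 < #|F i| ->
  exists2 x, x \in F i & strong_hall X (delete_at F i x).
Proof.
move=> hF iX F3.
have [x xF] : exists x, x \in F i by apply/card_gt0P; lia.
have [y yF] : exists y, y \in F i :\ x.
  by apply/card_gt0P; move: F3; rewrite (cardsD1 x) xF; lia.
have [hx|[A [iA AX leA]]] := delete_at_violation i x hF; first by exists x.
have [hy|[B [iB BX leB]]] := delete_at_violation i y hF.
  by exists y => //; case/setD1P: yF.
set P := _ :|: _ in leA; set Q := _ :|: _ in leB.
(* The union regains all of [F i]: as [x] and [y] differ, each survives the deletion of the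
   other. *)
have subU : \bigcup_(j in i |: (A :|: B)) F j \subset P :|: Q.
  apply/bigcupsP=> j /setU1P[->|/setUP[jA|jB]].
  - apply/subsetP=> z zF; rewrite !inE zF !andbT.
    case: (eqVneq z x) => [->|//]; case/setD1P: yF => yx _.
    by rewrite (eq_sym x) yx !orbT.
  - apply: subset_trans (subsetUl _ _); apply: subset_trans (subsetUr _ _).
    exact: bigcup_sup.
  - apply: subset_trans (subsetUr _ _); apply: subset_trans (subsetUr _ _).
    exact: bigcup_sup.
have iAB : i \notin A :|: B by rewrite inE negb_or iA iB.
have ltU : #|A :|: B|.+1 < #|P :|: Q|.
  apply: leq_trans (subset_leq_card subU).
  have := hF (i |: (A :|: B)); rewrite cardsU1 iAB add1n; apply.
    by rewrite setUA subUset AX /=; apply: subset_trans BX; rewrite subsetUr.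
  by apply/set0Pn; exists i; rewrite setU11.
have ltI : #|A :&: B| < #|P :&: Q|.
  (* Strong Hall is silent on the empty set; there a third vertex of [F i] lies in both [P] and
     [Q]. *)
  have [AB0|AB0] := eqVneq (A :&: B) set0.
    rewrite AB0 cards0; apply/card_gt0P.
    have [z] : exists z, z \in F i :\ x :\ y.
      apply/card_gt0P; move: F3.
      by rewrite (cardsD1 x) xF (cardsD1 y (_ :\ x)) yF; lia.
    by rewrite !inE => /and3P[zy zx zF]; exists z; rewrite !inE zy zx zF.
  apply: leq_trans (hF (A :&: B) _ AB0) _.
    apply: subset_trans (subsetIl _ _) _; apply: subset_trans AX.
    exact: subsetUr.
  apply/subset_leq_card/bigcupsP=> j /setIP[jA jB]; rewrite subsetI.
  by rewrite !(subset_trans _ (subsetUr _ _)) ?bigcup_sup.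
have := cardsUI A B; have := cardsUI P Q; lia.
Qed.

(** Each deletion lowers the total size of the sets. When no set has three elements left, strong
    Hall on singletons forces size exactly two. *)
Lemma strong_hall_pairs X F :
  strong_hall X F ->
  exists G, [/\ strong_hall X G, forall i, i \in X -> G i \subset F i &
                forall i, i \in X -> #|G i| = 2].
Proof.
have [n] := ubnP (\sum_(i in X) #|F i|).
elim: n F => // n IHn F leF hF.
case: (boolP [exists i in X, 2 < #|F i|]) => [/exists_inP[i iX F3]|/exists_inPn F2].
  have [x xF hG] := strong_hall_delete hF iX F3.
  have GF j : delete_at F i x j \subset F j.
    by rewrite /delete_at; case: eqP => // ->; apply: subD1set.
  have [|G [hG' GG' G2]] := IHn _ _ hG.
    move: leF; rewrite (bigD1 i) //= [X in _ -> X < _](bigD1 i) //= {1}/delete_at eqxx (cardsD1 x (F i)) xF.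
    have : \sum_(j in X | j != i) #|delete_at F i x j| <=
           \sum_(j in X | j != i) #|F j|.
      by apply: leq_sum => j _; apply: subset_leq_card.
    lia.
  by exists G; split=> // j jX; apply: subset_trans (GG' j jX) (GF j).
exists F; split=> // i iX; apply/eqP; rewrite eqn_leq leqNgt F2 //=.
have := hF [set i]; rewrite cards1 big_set1 sub1set; apply=> //.
by apply/set0Pn; exists i; rewrite set11.
Qed.

End StrongHall.

(** * Edge counts, connectivity and cycles in graphs *)

Section Graphs.

Variable V : finType.
Implicit Types (S T : {set {set V}}) (A : {set V}) (x y : V).

Lemma adj_sym S : symmetric (adj S).
Proof. by move=> x y; rewrite /adj setUC. Qed.

Lemma gforest_sub S T : S \subset T -> gforest T -> gforest S.
Proof.
move=> ST [TK noc]; split; first exact: subset_trans ST TK.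
move=> c c2 /andP[cyc uc]; apply: (noc c c2); rewrite /ucycle uc andbT.
by apply: sub_cycle cyc => x y; apply: (subsetP ST).
Qed.

Definition edges_in S A : {set {set V}} := [set e in S | e \subset A].

Lemma gforest_bridge S x y :
  gforest S -> [set x; y] \in S -> x != y ->
  ~~ connect (adj (S :\ [set x; y])) x y.
Proof.
move=> [SK noc] xyS xy; apply/negP=> /connectP[p0 pth lasty].
move: pth lasty; case/shortenP=> p pth up _ lasty.
(* An empty [p] would give [x = y], and a single step would use the removed edge. *)
have p2 : 2 < size (x :: p).
  case: p pth up lasty => [|z [|t p]] //=.
    by move=> _ _ yx; rewrite yx eqxx in xy.
  by rewrite /adj => /andP[+ _] _ yz; rewrite -yz !inE eqxx.
apply: (noc _ p2); rewrite /ucycle up andbT /= rcons_path -lasty.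
rewrite adj_sym {2}/adj xyS andbT.
by apply: sub_path pth => u v; rewrite /adj !inE => /andP[].
Qed.

Lemma complete_edgesP S e :
  S \subset complete_edges V -> e \in S ->
  exists x y, x != y /\ e = [set x; y].
Proof. by move=> /subsetP SK /SK; rewrite /complete_edges in_set => /cards2P. Qed.

Lemma edge_component S x e :
  S \subset complete_edges V -> e \in S ->
  (e \subset [set z | connect (adj S) x z]) ||
  (e \subset ~: [set z | connect (adj S) x z]).
Proof.
move=> SK eS; have [u [v [_ ee]]] := complete_edgesP SK eS.
have uv : connect (adj S) x u = connect (adj S) x v.
  apply/idP/idP=> h; apply: connect_trans h (connect1 _).
    by rewrite /adj -ee.
  by rewrite adj_sym /adj -ee.
by rewrite ee !subUset !sub1set !inE uv !andbb orbN.
Qed.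

Lemma card_edges_in_split S A x :
  S \subset complete_edges V ->
  #|edges_in S A| <= #|edges_in S (A :&: [set z | connect (adj S) x z])| +
                     #|edges_in S (A :\: [set z | connect (adj S) x z])|.
Proof.
move=> SK; apply: leq_trans _ (leq_card_setU _ _).1; apply: subset_leq_card.
apply/subsetP=> e; rewrite inE => /andP[eS eA].
by rewrite !inE setDE !subsetI eS eA edge_component.
Qed.

(** Removing an edge inside [A] separates its ends, so the component of [x] cuts [A] into two
    nonempty parts. Each part has fewer edges than vertices by induction; together they lack at
    least two, and the removed edge restores only one. *)
Lemma gforest_card_edges_in S A :
  gforest S -> A != set0 -> #|edges_in S A| < #|A|.
Proof.
have [n] := ubnP #|S|; elim: n S A => // n IHn S A leS fS A0.
have [->|] := eqVneq (edges_in S A) set0; first by rewrite cards0 card_gt0.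
case/set0Pn=> e; rewrite inE => /andP[eS eA].
have [x [y [xy ee]]] := complete_edgesP (proj1 fS) eS.
have /andP[xA yA] : (x \in A) && (y \in A) by rewrite -!sub1set -subUset -ee.
have fS' : gforest (S :\ e) := gforest_sub (subD1set S e) fS.
have nxy : ~~ connect (adj (S :\ e)) x y.
  by rewrite ee; apply: gforest_bridge => //; rewrite -ee.
have ltS : #|S :\ e| < n by move: leS; rewrite (cardsD1 e) eS.
have := card_edges_in_split A x (proj1 fS'); set B := [set z | _] => le1.
have lt2 : #|edges_in (S :\ e) (A :&: B)| < #|A :&: B|.
  by apply: IHn => //; apply/set0Pn; exists x; rewrite !inE xA connect0.
have lt3 : #|edges_in (S :\ e) (A :\: B)| < #|A :\: B|.
  by apply: IHn => //; apply/set0Pn; exists y; rewrite !inE yA nxy.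
have le4 : #|edges_in S A| <= #|edges_in (S :\ e) A|.+1.
  rewrite (cardsD1 e) inE eS eA ltnS; apply: subset_leq_card.
  by apply/subsetP=> g; rewrite !inE andbA.
have := cardsID B A; lia.
Qed.

Lemma edges_inT S : edges_in S setT = S.
Proof. by apply/setP=> e; rewrite inE subsetT andbT. Qed.

(** Otherwise the component of [x] and its complement are both nonempty, each with fewer edges than
    vertices, so [#|S|] is at most [#|V| - 2]. *)
Lemma gforest_connected S :
  gforest S -> #|V| <= #|S|.+1 -> forall x y, connect (adj S) x y.
Proof.
move=> fS leV x y; apply/negPn/negP=> nxy.
have := card_edges_in_split setT x (proj1 fS); set B := [set z | _] => le1.
have lt2 : #|edges_in S (setT :&: B)| < #|setT :&: B|.
  by apply: gforest_card_edges_in => //; apply/set0Pn; exists x; rewrite !inE connect0.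
have lt3 : #|edges_in S (setT :\: B)| < #|setT :\: B|.
  by apply: gforest_card_edges_in => //; apply/set0Pn; exists y; rewrite !inE nxy.
have := cardsID B setT; move: le1; rewrite edges_inT cardsT; lia.
Qed.

(* Take [A] as large as possible with at least [#|A| - 1] edges inside; an edge
   leaving [A] would allow [A] to grow. *)
Lemma connected_card_edges S :
  (forall x y, connect (adj S) x y) -> #|V| <= #|S|.+1.
Proof.
move=> conn; case: (pickP (mem [set: V])) => [x _|V0]; last first.
  by rewrite -cardsT eq_card0.
pose P A := (x \in A) && (#|A| <= #|edges_in S A|.+1).
have [|A /maxsetP[/andP[xA leA] maxA] _] := @maxset_exists V P [set x].
  by rewrite /P set11 cards1.
have clA : closed (adj S) (mem A).
  apply: (intro_closed (sym_connect_sym (@adj_sym S))) => u v uv uA.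
  apply/negPn/negP=> vA.
  have : P (v |: A).
    rewrite /P in_setU1 xA orbT cardsU1 vA /=.
    apply: leq_ltn_trans leA _; rewrite ltnS.
    have uvn : [set u; v] \notin edges_in S A.
      by rewrite inE subUset !sub1set (negbTE vA) !andbF.
    have := cardsU1 [set u; v] (edges_in S A); rewrite uvn add1n => <-.
    apply: subset_leq_card; apply/subsetP=> e; rewrite !inE.
    case/predU1P=> [->|/andP[-> eA]].
      by rewrite -/(adj S u v) uv subUset !sub1set !inE uA eqxx orbT.
    by rewrite (subset_trans eA) ?subsetUr.
  move/maxA => /(_ (subsetUr _ _)) vAA.
  by move: vA; rewrite -vAA setU11.
have AT : A = setT.
  by apply/setP=> y; rewrite inE -(closed_connect clA (conn x y)).
by move: leA; rewrite AT edges_inT cardsT.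
Qed.

(** Two vertices with the same pair would be each other's successors, closing the cycle after two
    steps. *)
Lemma next_edge_inj (c : seq V) :
  uniq c -> 2 < size c -> {in c &, injective (fun x => [set x; next c x])}.
Proof.
move=> uc c2 x y xc yc /= exy.
have := set21 x (next c x); rewrite exy !inE => /orP[/eqP//|/eqP xy].
have := set21 y (next c y); rewrite -exy !inE => /orP[/eqP//|/eqP yx].
case/rot_to: xc => i c' rotc; have := c2.
rewrite -(size_rot i) rotc => c'2.
move: yx xy; rewrite -!(next_rot i uc) rotc.
have : uniq (x :: c') by rewrite -rotc rot_uniq.
case: c' rotc c'2 => [|z [|t c']] //= _ _.
rewrite eqxx !inE !negb_or => /and3P[/and3P[xz xt xc'] /andP[zt zc'] _] ->.
by rewrite eq_sym (negbTE xz) eqxx => e; rewrite e eqxx in xt.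
Qed.

Lemma ucycle_edge_set S (c : seq V) :
  2 < size c -> ucycle (adj S) c ->
  exists D : {set {set V}}, [/\ D \subset S, #|D| = size c &
    \bigcup_(e in D) e \subset [set z in c]].
Proof.
move=> c2 /andP[cyc uc].
exists [set [set x; next c x] | x in c]; split.
- by apply/subsetP=> _ /imsetP[x xc ->]; exact: (next_cycle cyc xc).
- by rewrite card_in_imset ?(card_uniqP uc) //; exact: next_edge_inj.
- apply/bigcupsP=> _ /imsetP[x xc ->].
  by rewrite subUset !sub1set !inE mem_next xc.
Qed.

(** Two indices sharing a pair cover only two vertices, where strong Hall demands three. *)
Lemma strong_hall_inj (I : finType) (X : {set I}) (G : I -> {set V}) :
  strong_hall X G -> (forall i, i \in X -> #|G i| = 2) -> {in X &, injective G}.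
Proof.
move=> hG G2 i j iX jX Gij; apply/eqP/negPn/negP=> ij.
have := hG [set i; j]; rewrite subUset !sub1set iX jX cards2 ij.
rewrite bigcup_setU !big_set1 Gij setUid G2 // => /(_ isT).
suff -> : [set i; j] != set0 by move/(_ isT).
by apply/set0Pn; exists i; rewrite set21.
Qed.

Lemma strong_hall_gforest (I : finType) (X : {set I}) (G : I -> {set V}) :
  strong_hall X G -> (forall i, i \in X -> #|G i| = 2) -> gforest (G @: X).
Proof.
move=> hG G2; split.
  by apply/subsetP=> _ /imsetP[i iX ->]; rewrite inE G2.
move=> c c2 cyc; have [D [DS cardD covD]] := ucycle_edge_set c2 cyc.
(* The indices of the cycle's edges: by injectivity as many as the cycle has vertices, yet covering
   no other vertices. *)
pose C := [set i in X | G i \in D].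
have CX : C \subset X by apply/subsetP=> i; rewrite inE => /andP[].
have GC : G @: C = D.
  apply/setP=> e; apply/imsetP/idP=> [[i + ->]|eD]; first by rewrite inE => /andP[].
  by have /imsetP[i iX ei] := subsetP DS e eD; exists i; rewrite // inE iX -ei.
have cardC : #|C| = size c.
  rewrite -cardD -GC card_in_imset //.
  by apply: sub_in2 (strong_hall_inj hG G2); apply/subsetP.
have : #|C| < #|\bigcup_(i in C) G i|.
  by apply: hG => //; rewrite -card_gt0 cardC; lia.
apply/negP; rewrite -leqNgt cardC -(card_uniqP (proj2 (andP cyc))) -(cardsE (mem c)).
apply/subset_leq_card; apply: subset_trans covD; apply/bigcupsP=> i iC.
by apply: (bigcup_sup (G i)); rewrite // -GC imset_f.
Qed.

End Graphs.

(** * Hypergraph forests and trees *)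

Section Hypertrees.

Variables (V : finType) (H : hypergraph V).
Implicit Types (X : {set {set V}}) (f : {set V} -> {set V}).

(* A minimal violation of the strong Hall condition is a cycle. *)
Lemma hforest_strong_hall X : hforest H X -> strong_hall X id.
Proof.
move=> [XE noc]; case: (strong_hall_or_violation X id) => // -[C0 [C0X C00 leC0]].
pose P (C : {set {set V}}) := [&& C \subset X, C != set0 & #|cover C| <= #|C|].
have [|C /minsetP[/and3P[CX Cn0 leC] minC] _] := @minset_exists _ P C0.
  by rewrite /P C0X C00.
have ltD (D : {set {set V}}) : D \proper C -> D != set0 -> #|D| < #|cover D|.
  move=> DC Dn0; rewrite ltnNge; apply/negP=> leD.
  have PD : P D by rewrite /P Dn0 leD (subset_trans (proper_sub DC)).
  by have := DC; rewrite (minC D PD (proper_sub DC)) properxx.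
have CE := subset_trans CX XE.
case: (noc C CX); split=> // [|D DC Dn0 eqD]; last first.
  by have := ltD D DC Dn0; rewrite eqD ltnn.
apply/eqP; rewrite eqn_leq leC andbT.
(* Without [e] the rest of [C] is no violation, so it covers at least [#|C|] vertices; if nothing
   remains, nonemptiness of [e] suffices. *)
case/set0Pn: Cn0 => e eC.
have eN0 : 0 < #|cover C|.
  rewrite card_gt0; apply: contraTneq (edges_neq0 (subsetP CE e eC)) => cov0.
  by rewrite negbK -subset0 -cov0 bigcup_sup.
have [D0|Dn0] := eqVneq (C :\ e) set0; first by rewrite (cardsD1 e) eC D0 cards0.
have := ltD _ (properD1 eC) Dn0; rewrite (cardsD1 e C) eC => /leq_trans; apply.
apply/subset_leq_card/bigcupsP=> g /setD1P[_ gC]; exact: bigcup_sup.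
Qed.

Lemma hforest_pair_selection X :
  hforest H X -> exists f, pair_selection X f /\ gforest (f @: X).
Proof.
move=> /hforest_strong_hall/strong_hall_pairs[f [hf fX f2]].
exists f; split; last exact: strong_hall_gforest.
split; last exact: strong_hall_inj.
move=> e eX; have /eqP/cards2P[u [v [uv fe]]] := f2 e eX.
exists u, v; split=> //; apply: (subsetP (fX e eX)).
  by rewrite fe set21.
by rewrite fe set22.
Qed.

(** The pairs chosen for a cycle [C] are [#|cover C|] distinct forest edges inside [cover C], one
    more than a forest allows. *)
Lemma pair_selection_hforest X f :
  X \subset edges H -> pair_selection X f -> gforest (f @: X) -> hforest H X.
Proof.
move=> XE [fX injf] fF; split=> // C CX [_ Cn0 eqC _].
have cardf : #|f @: C| = #|C|.
  by rewrite card_in_imset //; apply: sub_in2 injf; apply/subsetP.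
have covC0 : cover C != set0 by rewrite -card_gt0 -eqC card_gt0.
have := gforest_card_edges_in (gforest_sub (imsetS f CX) fF) covC0.
rewrite -eqC ltnNge -cardf => /negP; apply; apply: subset_leq_card.
apply/subsetP=> _ /imsetP[e eC ->]; rewrite inE imset_f //=.
have [u [v [_ ue ve ->]]] := fX e (subsetP CX e eC).
by apply: subset_trans (bigcup_sup e eC); rewrite subUset !sub1set ue ve.
Qed.

End Hypertrees.

(** This reduces trees to forests, since an injective selection preserves the number of edges. *)
Lemma gtree_card (V : finType) (S : {set {set V}}) :
  gforest S -> gtree S <-> #|S|.+1 = #|V|.
Proof.
move=> fS; split=> [[_ V0 conn]|cardS].
  apply/eqP; rewrite eqn_leq connected_card_edges // andbT.
  have := @gforest_card_edges_in _ S setT fS.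
  by rewrite edges_inT cardsT -card_gt0 cardsT; apply.
split=> //; first by rewrite -cardS.
by apply: gforest_connected => //; rewrite cardS.
Qed.

Theorem mainTheorem11 (V : finType) (H : hypergraph V) (X : {set {set V}})
    (XE : X \subset edges H) :
  (hforest H X <->
     exists f : {set V} -> {set V}, pair_selection X f /\ gforest (f @: X)) /\
  (htree H X <->
     exists f : {set V} -> {set V}, pair_selection X f /\ gtree (f @: X)).
Proof.
split; split.
- exact: hforest_pair_selection.
- by case=> f [selX fF]; apply: pair_selection_hforest selX fF.
- case=> /hforest_pair_selection[f [selX fF]] cardX; exists f; split=> //.
  by apply/gtree_card; rewrite // card_in_imset //; case: selX.
- case=> f [selX tF]; have [fF _ _] := tF; split.
    exact: pair_selection_hforest selX fF.
  by move/(gtree_card fF): tF; rewrite card_in_imset //; case: selX.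
Qed.
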